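(* There exist absolute constants $c,C\ge 1$ and an online scheduler $\texttt{ALG}$ for the serial-parallel scheduling problem that is allowed to use cancelling, such that for every task arrival process $\mathcal{T}$, $$\mathrm{TRT}_{\texttt{ALG}}^{\mathcal{T}}\le C\cdot \mathrm{TRT}_{\texttt{OPT}}^{c\cdot\mathcal{T}};$$ that is, with $O(1)$ speed augmentation and cancelling, $\texttt{ALG}$ is $O(1)$-competitive for mean response time.
   Context: Serial-parallel scheduling problem: $p$ identical processors ($p$ at least a sufficiently large constant). A task arrival process (TAP) is a finite set of tasks $\tau_i=(\sigma_i,\pi_i,t_i)$, $i=1,\dots,n$, with arrival time $t_i\ge0$, serial work $\sigma_i$ and parallel work $\pi_i$, $1\le\pi_i/\sigma_i\le p$. A task is performed either by its serial job (work $\sigma_i$, at most one processor at any instant) or by its parallel job (work $\pi_i$, any number of processors, rate equal to number of processors). Time is continuous; processors are allocated (fractionally via time sharing) among arrived unfinished jobs; a job completes when the integral of its allocated processors reaches its work. Before starting a task the scheduler irrevocably chooses an implementation; preemption is allowed. A scheduler with cancelling may additionally stop a running task, erasing all its progress, and restart it with the other implementation. An online scheduler learns about a task only at its arrival. The total response time $\mathrm{TRT}^{\mathcal{T}}_{\texttt{ALG}}=\sum_i(f_i-t_i)$, where $f_i$ is the completion time of $\tau_i$; mean response time is $\mathrm{TRT}/n$. $\mathrm{TRT}^{\mathcal{T}}_{\texttt{OPT}}$ is the minimum total response time achievable by an offline (non-cancelling) schedule on $\mathcal{T}$. For $c>0$, $c\cdot\mathcal{T}$ is $\mathcal{T}$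 with all serial and parallel works multiplied by $c$ (equivalently, $\texttt{ALG}$ runs on processors $c$ times faster than $\texttt{OPT}$'s). *)

(* Defs.v *)
From HB Require Import structures.
From mathcomp Require Import all_boot all_order all_algebra.
From mathcomp Require Import all_classical all_reals.
From mathcomp Require Import topology normedtype sequences measure
  lebesgue_measure lebesgue_integral.
From mathcomp Require Import Rstruct Rstruct_topology.

Set Implicit Arguments.
Unset Strict Implicit.
Unset Printing Implicit Defensive.

Import Order.TTheory GRing.Theory Num.Theory.
Local Open Scope classical_set_scope.
Local Open Scope ring_scope.

Notation RR := Rdefinitions.R.

(* A task tau = (sigma, pi, t): serial work, parallel work, arrival time. *)
Record task := Task { sw : RR ; pw : RR ; arr : RR }.

Definition TAP := seq task.

Definition dtask : task := Task 1 1 0.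

Definition valid_task (p : nat) (tau : task) : Prop :=
  0 < sw tau /\ sw tau <= pw tau /\ pw tau <= p%:R * sw tau /\ 0 <= arr tau.

Definition valid_TAP (p : nat) (T : TAP) : Prop :=
  forall i, (i < size T)%N -> valid_task p (nth dtask T i).

Definition scale_TAP (c : RR) (T : TAP) : TAP :=
  [seq Task (c * sw tau) (c * pw tau) (arr tau) | tau <- T].

Definition integ (f : RR -> RR) (a b : RR) : \bar RR :=
  (\int[@lebesgue_measure RR]_(x in `[a, b]) (f x)%:E)%E.

Definition rmeasurable (f : (RR : realType) -> (RR : realType)) : Prop :=
  measurable_fun [set: (RR : realType)] f.

(* The schedule of a single task.
   - impl0 : implementation of the first run (true = parallel job,
             false = serial job);
   - cancels : the cancellation times b_1 <= ... <= b_k (empty for a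
             non-cancelling schedule); after each cancellation all progress
             is erased and the task restarts with the other implementation;
   - fin   : completion time f_i;
   - alloc : number of processors (fractional, via time sharing) allocated
             to the task at each instant. *)
Record task_sched := TaskSched {
  impl0 : bool ; cancels : seq RR ; fin : RR ; alloc : RR -> RR }.

(* A schedule for a TAP T: the schedule of the i-th task of T, i < size T. *)
Definition schedule := nat -> task_sched.

(* Boundaries of runs: t_i = b_0, b_1, ..., b_k, f_i.  Run j is [b_j, b_{j+1}). *)
Definition bounds (tau : task) (s : task_sched) : seq RR :=
  arr tau :: rcons (cancels s) (fin s).

Definition run_start tau s (j : nat) : RR := nth 0 (bounds tau s) j.
Definition run_end tau s (j : nat) : RR := nth 0 (bounds tau s) j.+1.

Definition run_impl (s : task_sched) (j : nat) : bool := impl0 s (+) odd j.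

Definition run_work (tau : task) (s : task_sched) (j : nat) : RR :=
  if run_impl s j then pw tau else sw tau.

Definition valid_task_sched (p : nat) (tau : task) (s : task_sched) : Prop :=
  let k := size (cancels s) in
  [/\
      sorted <=%R (bounds tau s) /\
      rmeasurable (alloc s),
      (forall x, 0 <= alloc s x) /\
      (forall x, x < arr tau \/ fin s <= x -> alloc s x = 0),
      (forall j x, (j <= k)%N -> run_impl s j = false ->
         run_start tau s j <= x < run_end tau s j -> alloc s x <= 1),
      (forall j, (j < k)%N ->
         (integ (alloc s) (run_start tau s j) (run_end tau s j)
           < (run_work tau s j)%:E)%E) &
      (integ (alloc s) (run_start tau s k) (fin s) = (run_work tau s k)%:E
       /\ forall x, run_start tau s k <= x < fin s ->
            (integ (alloc s) (run_start tau s k) x < (run_work tau s k)%:E)%E)].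

Definition valid_schedule (p : nat) (T : TAP) (S : schedule) : Prop :=
  (forall i, (i < size T)%N -> valid_task_sched p (nth dtask T i) (S i)) /\
  (forall x, \sum_(i < size T) alloc (S i) x <= p%:R).

Definition valid_noncancel_schedule (p : nat) (T : TAP) (S : schedule) : Prop :=
  valid_schedule p T S /\ forall i, (i < size T)%N -> cancels (S i) = [::].

Definition TRT (T : TAP) (S : schedule) : RR :=
  \sum_(i < size T) (fin (S i) - arr (nth dtask T i)).

Definition scheduler := TAP -> schedule.

Definition arrived_idx (T : TAP) (t : RR) : seq nat :=
  [seq i <- iota 0 (size T) | arr (nth dtask T i) <= t].

Definition arrived (T : TAP) (t : RR) : seq task :=
  [seq tau <- T | arr tau <= t].

Definition agree_upto (t : RR) (s s' : task_sched) : Prop :=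
  [/\ impl0 s = impl0 s',
      [seq b <- cancels s | b <= t] = [seq b <- cancels s' | b <= t] &
      forall x, x <= t -> alloc s x = alloc s' x].

Definition online (p : nat) (A : scheduler) : Prop :=
  forall (T T' : TAP) (t : RR), valid_TAP p T -> valid_TAP p T' ->
    arrived T t = arrived T' t ->
    forall k, (k < size (arrived_idx T t))%N ->
      agree_upto t (A T (nth 0 (arrived_idx T t) k))
                   (A T' (nth 0 (arrived_idx T' t) k)).

Definition online_cancelling_scheduler (p : nat) (A : scheduler) : Prop :=
  online p A /\ forall T, valid_TAP p T -> valid_schedule p T (A T).

(* Main.v *)
Require Import Defs.
From HB Require Import structures.
From mathcomp Require Import all_boot all_order all_algebra.
From mathcomp Require Import all_classical all_reals.
From mathcomp Require Import topology normedtype sequences measure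
  numfun measurable_realfun lebesgue_measure lebesgue_integral.
From mathcomp Require Import Rstruct Rstruct_topology.
From mathcomp Require Import ring lra.

Set Implicit Arguments.
Unset Strict Implicit.
Unset Printing Implicit Defensive.

Import Order.TTheory GRing.Theory Num.Theory.
Local Open Scope classical_set_scope.
Local Open Scope ring_scope.

(* The scheduler shares the processors equally: if n tasks are alive, each gets
   p / n processors. A task first runs in parallel; the serial clock, which
   advances at rate min(1, p / n), measures how far the serial job would have
   got meanwhile. When this clock reaches 8 sigma, the task is cancelled and run
   serially, with min(1, p / n) processors, which takes sigma more units of
   serial clock. At that moment the task has been alive for at least 8 sigma, so
   the serial phase is either short compared with the response time already
   paid, or takes place while n > p, when both jobs advance at the same rate.

   Let the competitor work at speed 1 / 72. At time t let n and m be the numbers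
   of tasks alive in the two schedules, and call late the tasks alive here but
   finished by the competitor. There are at least n - m late tasks, so pairing
   each late task i with the rank_i alive tasks that arrived no later than i
   gives n <= 2 m + 2 sum_(i late) rank_i / n. Since p / n is the rate at which
   the scheduler works on i, integrating rank_i / n counts, for each alive j
   that arrived before i, the work spent on i after the competitor finished it
   and before j finishes. This is at most 1/8 of the competitor's work on i, all
   of which was done while j was alive; summed over i and j it is at most 1/8 of
   the integral of n, as the competitor has only p processors. Hence the total
   response time is at most half of itself plus O(1) times the optimum. *)

(** * Integrals of bounded functions with bounded support *)

Section Integral.
Variable R : realType.
Implicit Types (F G : R -> R) (a b c r : R).

(** Half-open intervals let adjacent phases add up pointwise, with no endpoints to discard. *)
Definition ind a b : R -> R := fun t => ((a <= t) && (t < b))%:R.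

Definition bddm F := measurable_fun [set: R] F /\ exists M, forall t, `|F t| <= M.

(** The product with [ind a b] encodes support in one interval, which together with boundedness
    gives integrability. The class is stable under sums and under products with functions that are
    only [bddm]. *)
Definition nice F := bddm F /\ exists a b, forall t, F t = F t * ind a b t.

Definition lint F : R := \int[@lebesgue_measure R]_x F x.

Lemma measurable_ind a b : measurable_fun [set: R] (ind a b).
Proof.
suff -> : ind a b = \1_(`[a, b[%classic : set R) by exact: measurable_indic.
by apply/funext => t; rewrite indicE mem_setE /= in_itv.
Qed.

Lemma ind01 a b t : 0 <= ind a b t <= 1.
Proof. by rewrite /ind ler0n lern1 leq_b1. Qed.

Lemma ind_ge0 a b t : 0 <= ind a b t.
Proof. by case/andP: (ind01 a b t). Qed.

Lemma ind_le1 a b t : ind a b t <= 1.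
Proof. by case/andP: (ind01 a b t). Qed.

Lemma bddm_ind a b : bddm (ind a b).
Proof.
split; first exact: measurable_ind.
by exists 1 => t; rewrite ger0_norm ?ind_ge0 ?ind_le1.
Qed.

Lemma bddm_cst r : bddm (fun=> r).
Proof. by split; [exact: measurable_cst | exists `|r|]. Qed.

Lemma bddmD F G : bddm F -> bddm G -> bddm (fun t => F t + G t).
Proof.
move=> [mF [M hM]] [mG [N hN]]; split; first exact: measurable_funD.
by exists (M + N) => t; rewrite (le_trans (ler_normD _ _)) ?lerD.
Qed.

Lemma bddmM F G : bddm F -> bddm G -> bddm (fun t => F t * G t).
Proof.
move=> [mF [M hM]] [mG [N hN]]; split; first exact: measurable_funM.
by exists (M * N) => t; rewrite normrM ler_pM.
Qed.

Lemma nice_bddm F : nice F -> bddm F. Proof. by case. Qed.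

Lemma nice_ind a b : nice (ind a b).
Proof.
split; first exact: bddm_ind.
by exists a, b => t; rewrite /ind; case: (_ && _); rewrite ?mulr1 ?mulr0.
Qed.

Lemma niceMr F G : nice F -> bddm G -> nice (fun t => F t * G t).
Proof.
move=> [bF [a [b h]]] bG; split; first exact: bddmM.
by exists a, b => t; rewrite {1}h -!mulrA (mulrC (ind _ _ _)).
Qed.

Lemma niceMl F G : bddm F -> nice G -> nice (fun t => F t * G t).
Proof.
move=> bF nG; have := niceMr nG bF.
by under [X in nice X -> _]eq_fun do rewrite mulrC.
Qed.

Lemma niceD F G : nice F -> nice G -> nice (fun t => F t + G t).
Proof.
move=> [bF [a [b hF]]] [bG [c [d hG]]]; split; first exact: bddmD.
exists (Num.min a c), (Num.max b d) => t; rewrite mulrDl hF hG.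
have sub x y : (x = a /\ y = b) \/ (x = c /\ y = d) ->
    ind x y t = ind x y t * ind (Num.min a c) (Num.max b d) t.
  move=> hxy; rewrite /ind ge_min lt_max -natrM mulnb; congr (nat_of_bool _)%:R.
  by case: hxy => -[-> ->]; do 2!case: (_ <= t); do 2!case: (t < _).
by rewrite -!mulrA -!sub; auto.
Qed.

Lemma niceZ r F : nice F -> nice (fun t => r * F t).
Proof. exact: (niceMl (bddm_cst r)). Qed.

Lemma nice0 : nice (fun=> 0).
Proof.
have := niceZ 0 (nice_ind 0 0).
by under [X in nice X -> _]eq_fun do rewrite mul0r.
Qed.

Lemma nice_sum (I : Type) (s : seq I) (P : pred I) (F : I -> R -> R) :
  (forall i, nice (F i)) -> nice (fun t => \sum_(i <- s | P i) F i t).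
Proof.
move=> nF; elim: s => [|i s IH].
  by under eq_fun do rewrite big_nil; exact: nice0.
under eq_fun do rewrite big_cons.
by case: (P i) => //; apply: niceD.
Qed.

Lemma nice_integrable F :
  nice F -> (@lebesgue_measure R).-integrable [set: R] (EFin \o F).
Proof.
move=> [[mF [M hM]] [a [b h]]].
have iG : (@lebesgue_measure R).-integrable [set: R]
    (EFin \o (fun t => M * ind a b t)).
  rewrite (_ : _ \o _ = (fun t => M%:E * (EFin \o ind a b) t)%E) //.
  apply: integrableZl => //.
  suff -> : EFin \o ind a b = EFin \o \1_(`[a, b[%classic : set R).
    by apply: integrable_indic_itv.
  by apply/funext => t /=; rewrite indicE mem_setE /= in_itv.
apply: le_integrable iG => //; first by apply/measurable_EFinP.
move=> t _ /=; rewrite lee_fin {1}h normrM (ger0_norm (ind_ge0 _ _ _)).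
rewrite [leRHS]ger0_norm ?ler_wpM2r ?ind_ge0 //.
by rewrite mulr_ge0 ?ind_ge0 // (le_trans (normr_ge0 _) (hM t)).
Qed.

Lemma lint_ind a b : a <= b -> lint (ind a b) = b - a.
Proof.
move=> ab; rewrite /lint /Rintegral.
suff -> : (fun x => (ind a b x)%:E) = EFin \o \1_(`[a, b[%classic : set R).
  rewrite integral_indic // setIT /= lebesgue_measure_itv /= lte_fin.
  have [lt_ab//|ge_ab] := ltP a b.
  by rewrite (le_anti (introT andP (conj ab ge_ab))) subrr.
by apply/funext => t /=; rewrite indicE mem_setE /= in_itv.
Qed.

Lemma lintD F G : nice F -> nice G -> lint (fun t => F t + G t) = lint F + lint G.
Proof. by move=> /nice_integrable iF /nice_integrable iG; exact: RintegralD. Qed.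

Lemma lintZ r F : nice F -> lint (fun t => r * F t) = r * lint F.
Proof. by move=> /nice_integrable iF; exact: RintegralZl. Qed.

Lemma lint0 : lint (fun=> 0) = 0.
Proof.
have := lintZ 0 (nice_ind 0 0); rewrite mul0r => {2}<-.
by congr lint; apply/funext => t; rewrite mul0r.
Qed.

Lemma lint_sum (I : Type) (s : seq I) (P : pred I) (F : I -> R -> R) :
  (forall i, nice (F i)) ->
  lint (fun t => \sum_(i <- s | P i) F i t) = \sum_(i <- s | P i) lint (F i).
Proof.
move=> nF; elim: s => [|i s IH].
  by under eq_fun do rewrite big_nil; rewrite big_nil lint0.
under eq_fun do rewrite big_cons.
rewrite big_cons; case: (P i) => //.
by rewrite lintD ?IH //; exact: nice_sum.
Qed.

Lemma le_lint F G : nice F -> nice G -> (forall t, F t <= G t) ->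
  lint F <= lint G.
Proof.
by move=> /nice_integrable iF /nice_integrable iG FG; apply: le_Rintegral.
Qed.

Lemma lint_ge0 F : nice F -> (forall t, 0 <= F t) -> 0 <= lint F.
Proof. by move=> nF F0; rewrite -lint0; apply: le_lint => //; exact: nice0. Qed.

(** Passes from the closed intervals of [integ] to half-open ones; the endpoint has measure zero. *)
Lemma integral_lint F a b : bddm F ->
  (\int[@lebesgue_measure R]_(x in `[a, b]) (F x)%:E)%E
    = (lint (fun t => ind a b t * F t))%:E.
Proof.
move=> bF; have nF := niceMr (nice_ind a b) bF.
rewrite -(@integral_itv_bndo_bndc R (BLeft a) b); last first.
  by apply/measurable_EFinP; apply: measurable_funTS; case: bF.
rewrite /lint /Rintegral fineK; last first.
  by apply: integrable_fin_num => //; exact: nice_integrable nF.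
rewrite [LHS]integral_mkcond; apply: eq_integral => t _.
rewrite patchE mem_setE /= in_itv /= /ind.
by case: (_ && _); rewrite ?mul1r ?mul0r.
Qed.

Lemma indD a b c t : a <= b -> b <= c -> ind a c t = ind a b t + ind b c t.
Proof.
rewrite /ind => ab bc; have [tb|bt] := ltP t b.
  by rewrite (lt_le_trans tb bc) addr0.
by rewrite (le_trans ab bt) andbF add0r.
Qed.

End Integral.

(** * The competitive estimate *)

Section Competitive.
(** Arrivals are [a], completion times are [f] for the scheduler and [g] for the competitor, whose
    allocations are [o]. The rate [q] will be charged to the competitor's work, the rate [w] to
    response times. *)
Variables (R : realType) (N : nat) (a f g : 'I_N -> R) (o q w : 'I_N -> R -> R).
Variables (p theta eps kappa : R).

Definition alive (b : 'I_N -> R) (t : R) : R := \sum_i ind (a i) (b i) t.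

Hypotheses (p0 : 0 < p) (theta0 : 0 <= theta).
Hypotheses (af : forall i, a i <= f i) (ag : forall i, a i <= g i).
Hypotheses (no : forall i, nice (o i)) (o0 : forall i t, 0 <= o i t).
Hypothesis o_supp : forall i t, o i t = ind (a i) (g i) t * o i t.
Hypothesis o_cap : forall t, \sum_i o i t <= p.
Hypotheses (nq : forall i, nice (q i)) (q0 : forall i t, 0 <= q i t).
Hypotheses (nw : forall i, nice (w i)) (w0 : forall i t, 0 <= w i t).
(** If [q] equals p / n, with n tasks alive, this holds without [w], which compensates for instants
    at which [q] is smaller. *)
Hypothesis dom : forall i t r, a i <= t -> t < f i -> 0 <= r -> r <= alive f t ->
  r / alive f t <= r / p * q i t + w i t.
Hypothesis lint_q : forall i, lint (q i) <= theta * lint (o i).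
Hypothesis lint_w : forall i,
  lint (w i) <= eps * (f i - a i) + kappa * (g i - a i).

Let late i t := ind (g i) (f i) t.
Let rank i t := \sum_j (a j <= a i)%R%:R * ind (a j) (f j) t.

Lemma late_le i t : late i t <= ind (a i) (f i) t.
Proof.
rewrite /late /ind ler_nat; case: (leP (g i) t) => // gt.
by rewrite (le_trans (ag i) gt).
Qed.

Lemma alive_le_late t : alive f t <= alive g t + \sum_i late i t.
Proof.
rewrite -big_split /=; apply: ler_sum => i _; rewrite /late /ind.
rewrite -natrD ler_nat.
by case: (a i <= t); case: (ltP t (g i)); case: (t < f i).
Qed.

(* In the double sum every pair of late tasks is counted in at least one of its
   two orders, whatever the ties between arrival times. *)
Lemma sqr_late_le t : (\sum_i late i t) ^+ 2 <= 2 * \sum_i late i t * rank i t.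
Proof.
pose s i j := late i t * late j t * (a j <= a i)%R%:R.
have -> : (\sum_i late i t) ^+ 2 = \sum_i \sum_j late i t * late j t.
  by rewrite expr2 mulr_suml; apply: eq_bigr => i _; rewrite mulr_sumr.
have ss : \sum_i \sum_j late i t * late j t
    <= \sum_i \sum_j s i j + \sum_i \sum_j s j i.
  rewrite -big_split /=; apply: ler_sum => i _.
  rewrite -big_split /=; apply: ler_sum => j _.
  rewrite /s [late j t * late i t]mulrC -mulrDr ler_peMr ?mulr_ge0 ?ind_ge0 //.
  rewrite -natrD ler1n addn_gt0 !lt0b.
  by case: (leP (a j) (a i)) => // /ltW ->.
rewrite (le_trans ss) // [X in _ + X]exchange_big /=.
rewrite -mulr2n -[leLHS]mulr_natl ler_pM2l ?ltr0n //.
apply: ler_sum => i _; rewrite mulr_sumr; apply: ler_sum => j _.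
rewrite /s -mulrA ler_wpM2l ?ind_ge0 // mulrC ler_wpM2l ?ler0n //.
exact: late_le.
Qed.

Lemma alive_ge0 b t : 0 <= alive b t.
Proof. by apply: sumr_ge0 => i _; exact: ind_ge0. Qed.

Lemma rank_ge0 i t : 0 <= rank i t.
Proof. by apply: sumr_ge0 => j _; rewrite mulr_ge0 ?ind_ge0. Qed.

Lemma rank_le i t : rank i t <= alive f t.
Proof. by apply: ler_sum => j _; rewrite ler_piMl ?ind_ge0 // lern1 leq_b1. Qed.

(** Write n, m, l for the numbers of tasks alive here, alive at the competitor, and late. Either n
    <= m, or 0 < n - m <= l; in both cases n ^ 2 <= 2 n m + l ^ 2. Bound l ^ 2 by [sqr_late_le],
    divide by n, and apply [dom] with the rank as [r]. *)
Lemma alive_le t :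
  alive f t
    <= 2 * alive g t + 2 * \sum_i late i t * (rank i t / p * q i t + w i t).
Proof.
have s0 : 0 <= \sum_i late i t * (rank i t / p * q i t + w i t).
  apply: sumr_ge0 => i _; rewrite mulr_ge0 ?ind_ge0 // addr_ge0 //.
  by rewrite mulr_ge0 // divr_ge0 ?rank_ge0 // ltW.
have g0 := alive_ge0 g t.
have [f0|fpos] := leP (alive f t) 0; first lra.
have l_ge0 : 0 <= \sum_i late i t by apply: sumr_ge0 => i _; exact: ind_ge0.
have le1 := alive_le_late t.
have le2 := sqr_late_le t.
have le3 : (\sum_i late i t * rank i t) / alive f t
    <= \sum_i late i t * (rank i t / p * q i t + w i t).
  rewrite mulr_suml; apply: ler_sum => i _; rewrite -mulrA.
  have [ft|] := boolP ((g i <= t) && (t < f i)); last first.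
    by rewrite /late /ind => /negbTE ->; rewrite !mul0r.
  case/andP: (ft) => gt tf; rewrite ler_wpM2l ?ind_ge0 //.
  by apply: dom; rewrite ?rank_ge0 ?rank_le // (le_trans (ag i)).
rewrite ler_pdivrMr // in le3.
rewrite -(ler_pM2r fpos).
move: s0 g0 fpos l_ge0 le1 le2 le3.
move: (\sum_i late i t * (_ + _)) (\sum_i late i t * rank i t) => X Y.
move: (\sum_i late i t) (alive f t) (alive g t) => l n m.
move=> X0 m0 n0 l0 h1 h2 h3.
suff : n * n <= 2 * (n * m) + l ^+ 2 by lra.
have [nm|mn] := leP n m; first by nra.
have : (n - m) ^+ 2 <= l ^+ 2 by rewrite ler_sqr ?nnegrE; lra.
by nra.
Qed.

Lemma lint_alive b : (forall i, a i <= b i) ->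
  lint (alive b) = \sum_i (b i - a i).
Proof.
move=> ab; rewrite lint_sum; last by move=> i; exact: nice_ind.
by apply: eq_bigr => i _; rewrite lint_ind.
Qed.

Lemma nice_alive b : nice (alive b).
Proof. by apply: nice_sum => i; exact: nice_ind. Qed.

Let nice_ind_o i j : nice (fun t => ind (a j) (f j) t * o i t).
Proof. by apply: niceMr (nice_ind _ _) _; exact: nice_bddm. Qed.

(** Opening the sum in [rank] leaves these terms: work on the late task [i] charged to a task [j]
    that is alive and arrived no later. *)
Let pair i j t := (a j <= a i)%R%:R * (late i t * ind (a j) (f j) t * q i t).

Let nice_pair i j : nice (pair i j).
Proof.
apply: niceZ; apply: niceMl => //; apply: bddmM; exact: bddm_ind.
Qed.

(* If [g i < f j] and [a j <= a i] then task [j] is alive throughout the time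
   the competitor works on task [i]. *)
Lemma lint_pair_le i j :
  lint (pair i j) <= theta * lint (fun t => ind (a j) (f j) t * o i t).
Proof.
have R0 : 0 <= theta * lint (fun t => ind (a j) (f j) t * o i t).
  by rewrite mulr_ge0 ?lint_ge0 // => t; rewrite mulr_ge0 ?ind_ge0.
have [aji|aij] := leP (a j) (a i); last first.
  rewrite (_ : pair i j = fun=> 0) ?lint0 //.
  by apply/funext => t; rewrite /pair leNgt aij mul0r.
have [gf|fg] := ltP (g i) (f j); last first.
  rewrite (_ : pair i j = fun=> 0) ?lint0 //.
  apply/funext => t; rewrite /pair /late /ind.
  case: (leP (g i) t) => [gt|]; last by rewrite !(mul0r, mulr0).
  by rewrite (ltNge t (f j)) (le_trans fg gt) andbF !(mul0r, mulr0).
apply: (@le_trans _ _ (lint (q i))).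
  apply: le_lint => // t; rewrite /pair mulrA ler_piMl //.
  rewrite mulr_ile1 ?mulr_ge0 ?ind_ge0 ?mulr_ile1 ?ind_ge0 ?ind_le1 //.
  by rewrite lern1 leq_b1.
rewrite (le_trans (lint_q i)) // ler_wpM2l //; apply: le_lint => // t.
rewrite o_supp; have [/andP[at_ tg]|] := boolP ((a i <= t) && (t < g i)).
  by rewrite /ind (le_trans aji at_) (lt_trans tg gf) at_ tg !mul1r.
by rewrite /ind => /negbTE ->; rewrite !(mul0r, mulr0).
Qed.

Lemma competitive :
  \sum_i (f i - a i) <= 2 * (1 + kappa) * \sum_i (g i - a i)
                        + 2 * (theta + eps) * \sum_i (f i - a i).
Proof.
rewrite -(lint_alive af).
have nlw i : nice (fun t => late i t * w i t).
  by apply: niceMr (nice_ind _ _) _; exact: nice_bddm.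
have np i : nice (fun t => p^-1 * \sum_j pair i j t).
  by apply: niceZ; apply: nice_sum => j.
have le1 : lint (alive f) <= 2 * lint (alive g)
    + 2 * \sum_i (p^-1 * \sum_j lint (pair i j)
                  + lint (fun t => late i t * w i t)).
  pose G t := 2 * alive g t
    + 2 * \sum_i (p^-1 * \sum_j pair i j t + late i t * w i t).
  have n1 : nice (fun t => 2 * alive g t) by apply: niceZ; exact: nice_alive.
  have n2 i : nice (fun t => p^-1 * \sum_j pair i j t + late i t * w i t).
    exact: niceD.
  have n3 : nice (fun t => \sum_i (p^-1 * \sum_j pair i j t + late i t * w i t)).
    exact: nice_sum.
  have -> : 2 * lint (alive g)
    + 2 * \sum_i (p^-1 * \sum_j lint (pair i j)
                  + lint (fun t => late i t * w i t)) = lint G.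
    rewrite lintD //; last exact: niceZ.
    rewrite !lintZ //; last exact: nice_alive.
    congr (_ + _ * _); rewrite lint_sum //; apply: eq_bigr => i _.
    by rewrite lintD // lintZ ?lint_sum //; apply: nice_sum => j.
  apply: le_lint; [exact: nice_alive | by apply: niceD => //; exact: niceZ |].
  move=> t; apply: (le_trans (alive_le t)); rewrite /G lerD2l ler_wpM2l //.
  apply: ler_sum => i _; rewrite mulrDr lerD2r le_eqVlt; apply/orP; left.
  apply/eqP; rewrite /pair /rank !mulr_sumr !mulr_suml mulr_sumr.
  by apply: eq_bigr => j _; ring.
(* For fixed [j], the competitor's rates summed over [i] are at most [p] at every instant that [j]
   is alive; this [p] cancels the factor [p^-1]. *)
have le2 : \sum_i \sum_j lint (pair i j) <= theta * (p * lint (alive f)).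
  apply: (@le_trans _ _
      (\sum_i \sum_j theta * lint (fun t => ind (a j) (f j) t * o i t))).
    by apply: ler_sum => i _; apply: ler_sum => j _; exact: lint_pair_le.
  under eq_bigr do rewrite -mulr_sumr.
  rewrite -mulr_sumr ler_wpM2l // -lintZ; last exact: nice_alive.
  under eq_bigr do rewrite -lint_sum //.
  rewrite -lint_sum; last by move=> i; exact: nice_sum.
  apply: le_lint.
  - by apply: nice_sum => i; exact: nice_sum.
  - by apply: niceZ; exact: nice_alive.
  - move=> t; rewrite exchange_big /alive mulr_sumr; apply: ler_sum => j _ /=.
    by rewrite -mulr_sumr mulrC ler_wpM2r ?ind_ge0.
have le3 : \sum_i lint (fun t => late i t * w i t)
    <= eps * \sum_i (f i - a i) + kappa * \sum_i (g i - a i).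
  rewrite !mulr_sumr -big_split; apply: ler_sum => i _.
  apply: le_trans (lint_w i); apply: le_lint => // t.
  by rewrite ler_piMl // ind_le1.
rewrite big_split -mulr_sumr /= !lint_alive // in le1 le2 *.
have le4 : p^-1 * \sum_i \sum_j lint (pair i j) <= theta * \sum_i (f i - a i).
  by rewrite ler_pdivrMl //; lra.
lra.
Qed.

End Competitive.

(** * Trajectories of the scheduler *)

(** Membership needs equality on tasks. Trajectories are functions of the task itself, so equal
    entries of a TAP move together, while counts keep multiplicities. *)
HB.instance Definition _ := gen_eqMixin task.

Section Clock.
Implicit Types (T : TAP) (f : task -> RR) (phi : nat -> RR) (a b c s : RR).

Definition cnt T f (t : RR) : nat :=
  count (fun tau => (arr tau <= t) && (t < f tau)) T.

(** All alive tasks progress at one common rate, a function [phi] of their number, so a single clock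
    measures the progress of each. *)
Definition clock phi T f a b : RR :=
  lint (fun t : RR => ind a b t * phi (cnt T f t)).

Lemma cnt_size T f t : (cnt T f t <= size T)%N.
Proof. exact: count_size. Qed.

Lemma cnt_gt0 T f tau t :
  tau \in T -> arr tau <= t -> t < f tau -> (0 < cnt T f t)%N.
Proof.
by move=> Tt at_ tf; rewrite -has_count; apply/hasP; exists tau; rewrite ?at_.
Qed.

(** The induction generalizes [phi]: while the first task is alive, the remaining ones are seen
    through [phi] shifted by one. *)
Lemma bddm_cnt phi T f : bddm (fun t : RR => phi (cnt T f t)).
Proof.
elim: T phi => [|tau T IH] phi; first exact: (bddm_cst (phi 0%N)).
rewrite (_ : (fun _ => _) = fun t : RR =>
    ind (arr tau) (f tau) t * phi (1 + cnt T f t)%N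
    + (1 + -1 * ind (arr tau) (f tau) t) * phi (cnt T f t)).
  apply: bddmD; first exact: bddmM (bddm_ind _ _) (IH (phi \o addn 1)).
  apply: bddmM (IH phi); apply: bddmD; first exact: bddm_cst.
  by apply: bddmM; [exact: bddm_cst | exact: bddm_ind].
apply/funext => t; rewrite /cnt /= /ind; case: (_ && _) => /=.
  by rewrite mulN1r subrr mul0r addr0 mul1r.
by rewrite mulr0 mul0r add0r addr0 mul1r.
Qed.

Lemma nice_clock phi T f a b : nice (fun t : RR => ind a b t * phi (cnt T f t)).
Proof. exact: niceMr (nice_ind _ _) (bddm_cnt _ _ _). Qed.

Lemma clockD phi T f a b c : a <= b -> b <= c ->
  clock phi T f a c = clock phi T f a b + clock phi T f b c.
Proof.
move=> ab bc; rewrite /clock -lintD; [|exact: nice_clock..].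
by congr lint; apply/funext => t; rewrite (indD t ab bc) mulrDl.
Qed.

Lemma eq_clock phi T f T' f' a b :
  (forall t, a <= t -> t < b -> cnt T f t = cnt T' f' t) ->
  clock phi T f a b = clock phi T' f' a b.
Proof.
move=> eq_cnt; congr lint; apply/funext => t; rewrite /ind.
have [/andP[at_ tb]|_] := boolP (_ && _); last by rewrite !mul0r.
by rewrite eq_cnt.
Qed.

Lemma clock_cst phi T f a b n : a <= b ->
  (forall t, a <= t -> t < b -> cnt T f t = n) ->
  clock phi T f a b = phi n * (b - a).
Proof.
move=> ab eq_n; rewrite -(lint_ind ab) -lintZ; last exact: nice_ind.
congr lint; apply/funext => t; rewrite /ind.
have [/andP[at_ tb]|_] := boolP (_ && _); last by rewrite mul0r mulr0.
by rewrite mulrC eq_n.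
Qed.

Lemma clock_xx phi T f a : clock phi T f a a = 0.
Proof. by apply: (addrI (clock phi T f a a)); rewrite -clockD ?addr0. Qed.

Lemma clock_ge phi T f a b e : a <= b ->
  (forall t, a <= t -> t < b -> e <= phi (cnt T f t)) ->
  e * (b - a) <= clock phi T f a b.
Proof.
move=> ab le_e; rewrite -(lint_ind ab) -lintZ; last exact: nice_ind.
apply: le_lint; [exact: niceZ (nice_ind _ _) | exact: nice_clock |] => t.
rewrite mulrC /ind; have [/andP[at_ tb]|_] := boolP (_ && _).
  by rewrite ler_wpM2l ?le_e.
by rewrite !mul0r.
Qed.

Lemma clock_le phi T f a b e : a <= b ->
  (forall t, a <= t -> t < b -> phi (cnt T f t) <= e) ->
  clock phi T f a b <= e * (b - a).
Proof.
move=> ab le_e; rewrite -(lint_ind ab) -lintZ; last exact: nice_ind.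
apply: le_lint; [exact: nice_clock | exact: niceZ (nice_ind _ _) |] => t.
rewrite (mulrC e) /ind; have [/andP[at_ tb]|_] := boolP (_ && _).
  by rewrite ler_wpM2l ?le_e.
by rewrite !mul0r.
Qed.

End Clock.

(** * Processing rates *)

Section Rates.
Variable p : nat.

Definition prate (n : nat) : RR := p%:R / n%:R.
Definition srate (n : nat) : RR := Num.min 1 (prate n).

Hypothesis p_gt0 : (0 < p)%N.

Lemma prate_gt0 n : (0 < n)%N -> 0 < prate n.
Proof. by move=> n0; rewrite divr_gt0 ?ltr0n. Qed.

Lemma srate_gt0 n : (0 < n)%N -> 0 < srate n.
Proof. by move=> n0; rewrite lt_min ltr01 prate_gt0. Qed.

Lemma prate_ge0 n : 0 <= prate n.
Proof. by rewrite divr_ge0 ?ler0n. Qed.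

Lemma srate_ge0 n : 0 <= srate n.
Proof. by rewrite le_min ler01 prate_ge0. Qed.

Lemma srate_le1 n : srate n <= 1.
Proof. by rewrite ge_min lexx. Qed.

Lemma srate_le_prate n : srate n <= prate n.
Proof. by rewrite ge_min lexx orbT. Qed.

Lemma prate_anti m n : (0 < m)%N -> (m <= n)%N -> prate n <= prate m.
Proof.
move=> m0 mn; rewrite ler_wpM2l ?ler0n // lef_pV2 ?posrE ?ltr0n ?ler_nat //.
exact: leq_trans mn.
Qed.

Lemma srate_anti m n : (0 < m)%N -> (m <= n)%N -> srate n <= srate m.
Proof. move=> m0 mn; rewrite le_min srate_le1 /=.
exact: le_trans (srate_le_prate n) (prate_anti m0 mn). Qed.

(** Division by zero yields [prate p 0 = 0], so both conditions are restricted to positive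
    counts. *)
Definition is_rate (phi : nat -> RR) := (forall n, (0 < n)%N -> 0 < phi n) /\
  forall m n, (0 < m)%N -> (m <= n)%N -> phi n <= phi m.

Lemma is_rate_prate : is_rate prate.
Proof. by split; [exact: prate_gt0 | exact: prate_anti]. Qed.

Lemma is_rate_srate : is_rate srate.
Proof. by split; [exact: srate_gt0 | exact: srate_anti]. Qed.

(** While [tau] is alive the count lies between 1 and [size T], so the rate is at least
    [phi (size T)]. *)
Lemma clock_gt0 phi T f (tau : task) a b : is_rate phi ->
  tau \in T -> arr tau <= a -> a < b -> b <= f tau -> 0 < clock phi T f a b.
Proof.
move=> [phi0 phi_anti] Tt ta ab bf.
have T0 : (0 < size T)%N by case: (T) Tt.
apply: (@lt_le_trans _ _ (phi (size T) * (b - a))).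
  by rewrite mulr_gt0 ?phi0 ?subr_gt0.
apply: clock_ge => [|t at_ tb]; first exact: ltW.
apply: phi_anti; last exact: cnt_size.
by apply: cnt_gt0 Tt _ _; [exact: le_trans at_ | exact: lt_le_trans bf].
Qed.

End Rates.

(** * Causality of trajectories *)

Section Trajectory.
Variables (p : nat) (K : RR).
Hypotheses (p_gt0 : (0 < p)%N).

Local Notation pclock := (clock (prate p)).
Local Notation sclock := (clock (srate p)).

(* Task [tau] runs in parallel on [arr tau, h tau); it is finished at [h tau]
   if the parallel work is exhausted, and otherwise it is cancelled there and
   runs serially on [h tau, f tau). *)
Definition task_traj T (h f : task -> RR) (tau : task) : Prop :=
  [/\ arr tau <= h tau <= f tau,
      pclock T f (arr tau) (h tau) <= pw tau,
      sclock T f (arr tau) (h tau) <= K * sw tau,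
      h tau = f tau -> pclock T f (arr tau) (h tau) = pw tau &
      h tau < f tau -> [/\ pclock T f (arr tau) (h tau) < pw tau,
        sclock T f (arr tau) (h tau) = K * sw tau &
        sclock T f (h tau) (f tau) = sw tau]].

Definition traj T h f : Prop := forall tau, tau \in T -> task_traj T h f tau.

Lemma exists_min (A : eqType) (F : A -> RR) (s : seq A) (x : A) : x \in s ->
  exists2 y, y \in s & forall z, z \in s -> F y <= F z.
Proof.
elim: s x => // u s IH x _; case: s IH => [_|v s IH].
  by exists u; rewrite ?inE // => z; rewrite inE => /eqP ->.
have [y ys ymin] := IH v (mem_head _ _).
have [uy|yu] := leP (F u) (F y).
  exists u; first exact: mem_head.
  by move=> z; rewrite inE => /predU1P[->//|/ymin]; exact: le_trans.
exists y; first by rewrite inE ys orbT.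
by move=> z; rewrite inE => /predU1P[->|/ymin//]; exact: ltW.
Qed.

Lemma cnt_arrived T f t x : x <= t -> cnt T f x = cnt (arrived T t) f x.
Proof.
move=> xt; rewrite /cnt /arrived count_filter; apply: eq_count => tau /=.
by case: (leP (arr tau) x) => //= tx; rewrite (le_trans tx xt) andbT.
Qed.

Lemma mem_arrived T t tau : tau \in arrived T t -> tau \in T.
Proof. by rewrite mem_filter => /andP[]. Qed.

Lemma eq_cnt_below T T' (f f' : task -> RR) t e x :
  arrived T t = arrived T' t -> x <= t -> x < e ->
  (forall tau, tau \in arrived T t ->
     f tau = f' tau \/ e <= f tau /\ e <= f' tau) ->
  cnt T f x = cnt T' f' x.
Proof.
move=> eqT xt xe agree; rewrite (cnt_arrived T _ xt) (cnt_arrived T' _ xt) -eqT.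
apply: eq_in_count => tau /agree[->//|[ef ef']].
by rewrite !(lt_le_trans xe).
Qed.

Definition agree_before e (x y : RR) := x = y \/ e <= x /\ e <= y.

Lemma agree_beforeC e x y : agree_before e x y -> agree_before e y x.
Proof. by case=> [->|[]]; [left | right]. Qed.

(** Before [e] both trajectories have the same counts, hence the same clocks up to [e]. An event of
    [tau] at [e] in one of them only would let the clock that triggers it overrun its bound in the
    other. *)
Lemma no_first_event T T' h f h' f' t e :
  arrived T t = arrived T' t -> traj T h f -> traj T' h' f' -> e <= t ->
  (forall tau, tau \in arrived T t ->
     agree_before e (h tau) (h' tau) /\ agree_before e (f tau) (f' tau)) ->
  forall tau, tau \in arrived T t ->
    ~ (h tau = e /\ e < h' tau) /\ ~ (f tau = e /\ e < f' tau).
Proof.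
move=> eqT sol sol' et agree tau Qtau.
have Ttau : tau \in T := mem_arrived Qtau.
have T'tau : tau \in T' by rewrite eqT in Qtau; exact: mem_arrived Qtau.
have [/andP[ah hf] _ _ hf1 hf2] := sol _ Ttau.
have [/andP[ah' hf'] P' S' hf1' hf2'] := sol' _ T'tau.
have eqc phi a b : b <= e -> clock phi T f a b = clock phi T' f' a b.
  move=> be; apply: eq_clock => x _ xb.
  have xe := lt_le_trans xb be.
  apply: (eq_cnt_below eqT (ltW (lt_le_trans xe et)) xe) => u /agree[_].
  by case=> [->|]; [left | right].
have nh : ~ (h tau = e /\ e < h' tau).
  move=> [he eh'].
  have ae : arr tau <= e by rewrite -he.
  have gt phi : is_rate phi ->
      clock phi T f (arr tau) (h tau) < clock phi T' f' (arr tau) (h' tau).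
    move=> rphi; rewrite eqc ?he // (clockD _ _ _ ae (ltW eh')) ltrDl.
    exact: clock_gt0 rphi T'tau ae eh' hf'.
  have gtP := gt _ (is_rate_prate p_gt0); have gtS := gt _ (is_rate_srate p_gt0).
  move: hf; rewrite le_eqVlt => /predU1P[/hf1|/hf2[_]].
    by move=> eP; rewrite eP ltNge P' in gtP.
  by move=> eS _; rewrite eS ltNge S' in gtS.
split=> // -[fe ef'].
have hh' : h tau = h' tau.
  have [[//|[eh eh']] _] := agree _ Qtau.
  have he : h tau = e by apply/le_anti; rewrite eh -fe hf.
  by case: (ltgtP e (h' tau)) => [lt|lt|<-//];
    [case: nh | rewrite leNgt lt in eh'].
have he : h tau <= e by rewrite -fe.
(* The switch times agree. Either one trajectory finishes in parallel where the other cancels,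
   making one clock both equal to and below [pw tau], or both run serially and a strictly increasing
   clock reaches [sw tau] at two different times. *)
move: hf; rewrite le_eqVlt => /predU1P[hf|hf].
  have h'f' : h' tau < f' tau by rewrite -hh' hf fe.
  have [ltP _ _] := hf2' h'f'.
  by rewrite -hh' -eqc // hf1 // ltxx in ltP.
have [_ _ eS] := hf2 hf.
have h'f' : h' tau < f' tau by rewrite -hh' (lt_trans hf) // fe.
have [_ _ eS'] := hf2' h'f'.
have : sclock T' f' (h tau) e < sclock T' f' (h tau) (f' tau).
  rewrite [ltRHS](clockD _ _ _ he (ltW ef')) ltrDl.
  have r := is_rate_srate p_gt0.
  by apply: (clock_gt0 r T'tau _ ef') => //; exact: le_trans he.
by rewrite -eqc // -{1}fe eS hh' eS' ltxx.
Qed.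

(** Consider the earliest instant [e] at which some pair of event times differs. If [e <= t],
    everything agrees before [e], and [no_first_event], applied in both directions, excludes the
    difference. *)
Lemma traj_causal T T' h f h' f' t :
  arrived T t = arrived T' t -> traj T h f -> traj T' h' f' ->
  forall tau, tau \in arrived T t ->
    (h tau = h' tau \/ t < h tau /\ t < h' tau) /\
    (f tau = f' tau \/ t < f tau /\ t < f' tau).
Proof.
move=> eqT sol sol' tau0 Q0.
pose Q := arrived T t.
pose E := [seq Num.min (h u) (h' u) | u <- Q & h u != h' u]
       ++ [seq Num.min (f u) (f' u) | u <- Q & f u != f' u].
have Eh u : u \in Q -> h u != h' u -> Num.min (h u) (h' u) \in E.
  move=> Qu hu; rewrite mem_cat; apply/orP; left.
  by apply: (map_f (fun u => Num.min (h u) (h' u))); rewrite mem_filter hu.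
have Ef u : u \in Q -> f u != f' u -> Num.min (f u) (f' u) \in E.
  move=> Qu fu; rewrite mem_cat; apply/orP; right.
  by apply: (map_f (fun u => Num.min (f u) (f' u))); rewrite mem_filter fu.
have [/hasP[e0 E0 e0t]|/hasPn late] := boolP (has (<= t) E); last first.
  split.
    have [->|hh] := eqVneq (h tau0) (h' tau0); [by left | right].
    by have := late _ (Eh _ Q0 hh); rewrite -ltNge lt_min => /andP.
  have [->|ff] := eqVneq (f tau0) (f' tau0); [by left | right].
  by have := late _ (Ef _ Q0 ff); rewrite -ltNge lt_min => /andP.
have [e Ee emin] := @exists_min _ id _ _ E0.
have et : e <= t := le_trans (emin _ E0) e0t.
have agree u : u \in Q ->
    agree_before e (h u) (h' u) /\ agree_before e (f u) (f' u).
  move=> Qu; split.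
    have [->|hh] := eqVneq (h u) (h' u); [by left | right].
    by have := emin _ (Eh _ Qu hh); rewrite /= le_min => /andP.
  have [->|ff] := eqVneq (f u) (f' u); [by left | right].
  by have := emin _ (Ef _ Qu ff); rewrite /= le_min => /andP.
have agree' u : u \in arrived T' t ->
    agree_before e (h' u) (h u) /\ agree_before e (f' u) (f u).
  by rewrite -eqT => /agree[? ?]; split; exact: agree_beforeC.
have N := no_first_event eqT sol sol' et agree.
have N' := no_first_event (esym eqT) sol' sol et agree'.
have Q' u : u \in Q -> u \in arrived T' t by rewrite -eqT.
exfalso; move: Ee; rewrite mem_cat => /orP[] /mapP[u];
  rewrite mem_filter => /andP[+ Qu]; have [N1 N2] := N _ Qu;
  have [N1' N2'] := N' _ (Q' _ Qu); case: ltgtP => // lt _ eu.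
- by apply: N1; rewrite eu.
- by apply: N1'; rewrite eu.
- by apply: N2; rewrite eu.
- by apply: N2'; rewrite eu.
Qed.

End Trajectory.

(** * Existence of trajectories, event by event *)

Section Existence.
Variables (p : nat) (K : RR) (T : TAP).
Hypotheses (p_gt0 : (0 < p)%N) (K_ge0 : 0 <= K).
Hypothesis T_valid : forall tau, tau \in T -> valid_task p tau.

Local Notation pclock := (clock (prate p) T).
Local Notation sclock := (clock (srate p) T).

Implicit Types (h f : task -> RR) (lev : task -> nat) (s d : RR).

(* A trajectory known up to time [s]. The values 0, 1, 2, 3 of [lev tau] mean
   that [tau] has not arrived, runs in parallel, runs serially, is finished;
   tasks whose next event takes place exactly at time [s] may still be at the
   previous level. The yet unknown values of [h tau] and [f tau] are set to
   [s], or to [arr tau] before the arrival. *)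
Definition partial_task s h f lev tau : Prop :=
  match lev tau with
  | 0 => [/\ s <= arr tau, h tau = arr tau & f tau = arr tau]
  | 1 => [/\ arr tau <= s, h tau = s, f tau = s,
             pclock f (arr tau) s <= pw tau & sclock f (arr tau) s <= K * sw tau]
  | 2 => [/\ arr tau <= h tau <= s, f tau = s,
             pclock f (arr tau) (h tau) < pw tau,
             sclock f (arr tau) (h tau) = K * sw tau &
             sclock f (h tau) s <= sw tau]
  | _ => f tau <= s /\ task_traj p K T h f tau
  end.

Definition partial_traj s h f lev : Prop :=
  forall tau, tau \in T -> partial_task s h f lev tau.

Section Advance.
Variables (s d : RR) (h f : task -> RR) (lev : task -> nat).
Hypotheses (d_ge0 : 0 <= d) (known : partial_traj s h f lev).

Definition running tau := (lev tau == 1%N) || (lev tau == 2%N).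
Definition nrun : nat := count running T.
Definition h_adv tau := if lev tau == 1%N then s + d else h tau.
Definition f_adv tau := if running tau then s + d else f tau.

(** Time left until the next event of [tau] if the number of running tasks stays [nrun]; it is
    consulted only below level 3. *)
Definition delay tau : RR :=
  match lev tau with
  | 0 => arr tau - s
  | 1 => Num.min ((pw tau - pclock f (arr tau) s) / prate p nrun)
                 ((K * sw tau - sclock f (arr tau) s) / srate p nrun)
  | _ => (sw tau - sclock f (h tau) s) / srate p nrun
  end.

Lemma s_adv : s <= s + d. Proof. by rewrite lerDl. Qed.

Lemma nrun_gt0 tau : tau \in T -> running tau -> (0 < nrun)%N.
Proof. by move=> Tt rt; rewrite -has_count; apply/hasP; exists tau. Qed.

Lemma cnt_adv_before t : t < s -> cnt T f_adv t = cnt T f t.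
Proof.
move=> ts; apply: eq_in_count => tau Tt; rewrite /f_adv /running.
have := known Tt; rewrite /partial_task.
case: (lev tau) => [|[|[|k]]] //=.
- by case=> _ _ -> _ _; rewrite ts (lt_le_trans ts s_adv).
- by case=> _ -> _ _ _; rewrite ts (lt_le_trans ts s_adv).
Qed.

(** The placeholder values matter here: with [f tau = arr tau] a task that has not arrived is never
    counted, and with [f_adv tau = s + d] a running one is counted up to the new horizon. *)
Lemma cnt_adv_during t : s <= t -> t < s + d -> cnt T f_adv t = nrun.
Proof.
move=> st td; apply: eq_in_count => tau Tt; rewrite /f_adv /running.
have := known Tt; rewrite /partial_task.
case: (lev tau) => [|[|[|k]]] /=.
- by case=> _ _ ->; rewrite leNgt andNb.
- by case=> as_ _ _ _ _; rewrite (le_trans as_ st) td.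
- by case=> /andP[ah hs] _ _ _ _; rewrite (le_trans (le_trans ah hs) st) td.
- by case=> fs _; rewrite ltNge (le_trans fs st) andbF.
Qed.

Lemma clock_adv_before phi a b : b <= s ->
  clock phi T f_adv a b = clock phi T f a b.
Proof.
move=> bs; apply: eq_clock => t _ tb.
by rewrite cnt_adv_before // (lt_le_trans tb).
Qed.

Lemma clock_adv phi a : a <= s ->
  clock phi T f_adv a (s + d) = clock phi T f a s + phi nrun * d.
Proof.
move=> as_; rewrite (clockD _ _ _ as_ s_adv) clock_adv_before //.
rewrite (clock_cst _ s_adv cnt_adv_during).
by rewrite [s + d]addrC addrK.
Qed.

Lemma task_traj_adv tau : tau \in T -> ~~ running tau -> f tau <= s ->
  task_traj p K T h f tau -> task_traj p K T h_adv f_adv tau.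
Proof.
move=> Tt nr fs; rewrite /task_traj /h_adv /f_adv (negbTE nr).
have -> : (lev tau == 1%N) = false by apply: contraNF nr; rewrite /running => ->.
case=> /andP[ah hf] c1 c2 c3 c4; have hs := le_trans hf fs.
by rewrite !clock_adv_before // ah hf.
Qed.

Lemma partial_adv :
  (forall tau, tau \in T -> (lev tau < 3)%N -> d <= delay tau) ->
  partial_traj (s + d) h_adv f_adv lev.
Proof.
move=> le_delay tau Tt; have s_le := s_adv.
have := le_delay _ Tt; have := known Tt.
have := @nrun_gt0 _ Tt; have := @task_traj_adv _ Tt.
have : f_adv tau = if running tau then s + d else f tau by [].
have : h_adv tau = if lev tau == 1%N then s + d else h tau by [].
rewrite /partial_task /delay /running => -> ->.
case: (lev tau) => [|[|[|k]]] /=.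
- by move=> _ _ [sa ha fa] /(_ isT) dd; split=> //; lra.
- move=> _ /(_ isT) n0 [as_ _ _ cp cs] /(_ isT).
  rewrite le_min !ler_pdivlMr ?prate_gt0 ?srate_gt0 // => /andP[dp ds].
  by split=> //; rewrite ?clock_adv //; lra.
- move=> _ /(_ isT) n0 [/andP[ah hs] _ cp cs cc] /(_ isT).
  rewrite ler_pdivlMr ?srate_gt0 // => dd.
  by split=> //; rewrite ?clock_adv ?clock_adv_before ?ah //; lra.
- by move=> adv _ [fs tr] _; split; [lra | exact: adv].
Qed.

Lemma partial_bump tau : tau \in T -> (lev tau < 3)%N -> delay tau = d ->
  partial_traj (s + d) h_adv f_adv lev ->
  exists2 l, (lev tau < l <= 3)%N &
    forall lev', lev' tau = l -> partial_task (s + d) h_adv f_adv lev' tau.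
Proof.
move=> Tt; have := @nrun_gt0 _ Tt; have [sw0 [swpw _]] := T_valid Tt.
move=> n0 + ed known'; have := known' _ Tt; have := known Tt; move: ed n0.
rewrite /partial_task /delay /task_traj /running.
case el: (lev tau) => [|[|[|k]]] //=.
- move=> ed _ [sa _ _] [_ ha fa] _.
  have as_ : arr tau = s + d by lra.
  exists 1%N => // lev' ->; rewrite ha fa as_ !clock_xx; split=> //; first lra.
  by rewrite mulr_ge0 // ltW.
- move=> ed /(_ isT) n0 [as_ _ _ cp cs] [asd hd fd cpd csd] _.
  (* If both clocks run out together, completion takes precedence over cancelling. *)
  have [eqp|nep] := eqVneq (pclock f_adv (arr tau) (s + d)) (pw tau).
    exists 3%N => // lev' ->; rewrite hd fd asd lexx ltxx; split=> //; split=> //.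
  have ltp : pclock f_adv (arr tau) (s + d) < pw tau by rewrite lt_neqAle nep.
  exists 2%N => // lev' ->.
  rewrite hd fd asd lexx clock_xx; split=> //; last exact: ltW.
  rewrite clock_adv // in ltp; rewrite clock_adv //.
  move: ed; rewrite minElt; case: ifP => _ ed.
    by move: ltp; rewrite -ed mulrC divfK ?gt_eqF ?prate_gt0 //; lra.
  by rewrite -ed mulrC divfK ?gt_eqF ?srate_gt0 //; lra.
- move=> ed /(_ isT) n0 [/andP[ah hs] _ cp cs cc].
  move=> [/andP[ah' hs'] fd cp' cs' cc'] _.
  have hadv : h_adv tau = h tau by rewrite /h_adv el.
  have ec : sclock f_adv (h_adv tau) (s + d) = sw tau.
    rewrite hadv clock_adv // -ed mulrC divfK ?gt_eqF ?srate_gt0 //; lra.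
  exists 3%N => // lev' ->; rewrite fd ec ah' hs' /=; split=> //; split=> //.
  - exact: ltW.
  - by rewrite cs'.
  (* An empty serial phase cannot supply the positive work [sw tau]. *)
  - by move=> hsd; move: ec sw0; rewrite hsd clock_xx => ->; rewrite ltxx.
Qed.

Lemma delay_ge0 tau : tau \in T -> (lev tau < 3)%N -> 0 <= delay tau.
Proof.
move=> Tt; have := known Tt; have := @nrun_gt0 _ Tt.
rewrite /partial_task /delay /running.
case: (lev tau) => [|[|[|k]]] //=.
- by move=> _ [sa _ _] _; rewrite subr_ge0.
- move=> /(_ isT) n0 [_ _ _ cp cs] _.
  by rewrite le_min !divr_ge0 ?subr_ge0 // ltW ?prate_gt0 ?srate_gt0.
- move=> /(_ isT) n0 [_ _ _ _ cc] _.
  by rewrite divr_ge0 ?subr_ge0 // ltW ?srate_gt0.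
Qed.

End Advance.

(** Advancing by the least delay overshoots no clock, and the task attaining it reaches its next
    level. *)
Lemma partial_step s h f lev tau0 :
  partial_traj s h f lev -> tau0 \in T -> (lev tau0 < 3)%N ->
  exists s' h' f' lev' tau1, [/\ partial_traj s' h' f' lev',
    forall tau, (lev tau <= lev' tau)%N, tau1 \in T &
    (lev tau1 < lev' tau1 <= 3)%N].
Proof.
move=> known T0 lev0.
have : tau0 \in [seq tau <- T | (lev tau < 3)%N] by rewrite mem_filter lev0.
case/(exists_min (delay s h f lev)) => tau1.
rewrite mem_filter => /andP[lev1 T1] min1.
have known' : partial_traj (s + delay s h f lev tau1)
    (h_adv s (delay s h f lev tau1) h lev)
    (f_adv s (delay s h f lev tau1) f lev) lev.
  apply: partial_adv => //; first exact: delay_ge0.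
  by move=> tau Tt levt; apply: min1; rewrite mem_filter levt.
have [l /andP[lt_l l3] bumped] := partial_bump
  (delay_ge0 known T1 lev1) known T1 lev1 erefl known'.
pose lev' tau := if tau == tau1 then l else lev tau.
exists (s + delay s h f lev tau1), (h_adv s (delay s h f lev tau1) h lev),
  (f_adv s (delay s h f lev tau1) f lev), lev', tau1.
split=> //; last by rewrite /lev' eqxx lt_l.
  move=> tau Tt; have [->|ne] := eqVneq tau tau1.
    by apply: bumped; rewrite /lev' eqxx.
  have := known' _ Tt; rewrite /partial_task.
  suff -> : lev' tau = lev tau by [].
  by rewrite /lev' (negbTE ne).
by move=> tau; rewrite /lev'; case: eqVneq => // ->; exact: ltnW.
Qed.

(** Levels never drop, and each step raises one, so the sum of [3 - lev tau] decreases. The start is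
    time 0 with every task at level 0, as arrival times are nonnegative. *)
Lemma exists_traj : exists h f, traj p K T h f.
Proof.
suff from k s h f lev : partial_traj s h f lev ->
    (\sum_(tau <- T) (3 - lev tau) < k)%N -> exists h f, traj p K T h f.
  apply: (from _ 0 arr arr (fun=> 0%N) _ (ltnSn _)) => tau Tt.
  by have [_ [_ [_ a0]]] := T_valid Tt.
elim: k s h f lev => // k IH s h f lev known.
have [/hasP[tau0 T0 lev0]|/hasPn all3 _] :=
    boolP (has (fun tau => lev tau < 3)%N T).
  have [s' [h' [f' [lev' [tau1 [known' le_lev T1 /andP[lt3 le3]]]]]]] :=
    partial_step known T0 lev0.
  rewrite ltnS => le_k; apply: IH known' _; apply: leq_trans le_k.
  rewrite !(big_rem tau1 T1) /= -addSn leq_add //.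
    by rewrite ltn_sub2l // (leq_trans lt3).
  by apply: leq_sum => tau _; rewrite leq_sub2l.
exists h, f => tau Tt; have := known _ Tt; rewrite /partial_task.
by have := all3 _ Tt; case: (lev tau) => [|[|[|l]]] //= _ [].
Qed.

End Existence.

(** * The scheduler *)

Section Schedule.
Variables (p : nat) (K : RR).
Hypotheses (p_gt0 : (0 < p)%N) (K_ge0 : 0 <= K).

Local Notation pclock := (clock (prate p)).
Local Notation sclock := (clock (srate p)).

(** The trajectory is picked by choice, with a dummy default. Causality of all trajectories is what
    makes this choice online. *)
Definition the_traj T : (task -> RR) * (task -> RR) :=
  xget (arr, arr) [set hf | traj p K T hf.1 hf.2].

Definition tswitch T := (the_traj T).1.
Definition tfin T := (the_traj T).2.

Definition talloc T tau (t : RR) : RR :=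
  ind (arr tau) (tswitch T tau) t * prate p (cnt T (tfin T) t)
  + ind (tswitch T tau) (tfin T tau) t * srate p (cnt T (tfin T) t).

(** Completion in parallel shows as equal switch and completion times, and then no cancellation is
    recorded. *)
Definition tsched T tau : task_sched :=
  TaskSched true (if tswitch T tau < tfin T tau then [:: tswitch T tau] else [::])
    (tfin T tau) (talloc T tau).

Definition equi : scheduler := fun T i => tsched T (nth dtask T i).

Lemma valid_mem T tau : valid_TAP p T -> tau \in T -> valid_task p tau.
Proof. by move=> vT /(nthP dtask)[i iT <-]; exact: vT. Qed.

Lemma the_trajP T : valid_TAP p T -> traj p K T (tswitch T) (tfin T).
Proof.
move=> vT; have [h [f hf]] := exists_traj p_gt0 K_ge0 (fun _ => valid_mem vT).
apply: (@xgetPex _ (arr, arr) [set hf | traj p K T hf.1 hf.2]).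
by exists (h, f).
Qed.

Lemma arrivedE T t :
  arrived T t = [seq nth dtask T i | i <- arrived_idx T t].
Proof.
rewrite /arrived_idx -(filter_map (nth dtask T) (fun tau => arr tau <= t)).
by rewrite map_nth_iota0 // take_size.
Qed.

(** Equal arrived lists place the same task at position [k]. Its schedule up to [t] depends only on
    comparing instants [x <= t] with event times, which by [traj_causal] are equal or both beyond
    [t]. *)
Lemma equi_online : online p equi.
Proof.
move=> T T' t vT vT' eqT k kT.
have kT' : (k < size (arrived_idx T' t))%N.
  by rewrite -(size_map (nth dtask T')) -arrivedE -eqT arrivedE size_map.
have nthE : nth dtask T' (nth 0%N (arrived_idx T' t) k)
    = nth dtask T (nth 0%N (arrived_idx T t) k).
  by rewrite -!(nth_map _ dtask) // -!arrivedE eqT.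
rewrite /equi nthE.
have Q : nth dtask T (nth 0%N (arrived_idx T t) k) \in arrived T t.
  by rewrite arrivedE map_f // mem_nth.
have causal := traj_causal p_gt0 eqT (the_trajP vT) (the_trajP vT').
move: {nthE} (nth dtask T _) Q => tau Q.
have [hh' ff'] := causal _ Q.
have eq_ind (x y x' y' u : RR) : u <= t -> x = x' \/ t < x /\ t < x' ->
    y = y' \/ t < y /\ t < y' -> ind x y u = ind x' y' u.
  move=> ut xx' yy'; rewrite /ind; congr (nat_of_bool (_ && _))%:R.
    case: xx' => [->//|[/(le_lt_trans ut) ux /(le_lt_trans ut) ux']].
    by rewrite !leNgt ux ux'.
  by case: yy' => [->//|[/(le_lt_trans ut) -> /(le_lt_trans ut) ->]].
have cancelE (b : bool) x : [seq y <- if b then [:: x] else [::] | y <= t]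
    = if b && (x <= t) then [:: x] else [::] by case: b.
split=> //=.
  rewrite !cancelE; case: hh' => [<-|[th th']]; last first.
    by rewrite (leNgt _ t) th (leNgt _ t) th' !andbF.
  have [ht|th] := leP (tswitch T tau) t; last by rewrite !andbF.
  by rewrite !andbT; case: ff' => [->|[tf tf']] //; rewrite !(le_lt_trans ht).
move=> x xt; rewrite /talloc.
have -> : cnt T (tfin T) x = cnt T' (tfin T') x.
  have xx : x < x + 1 by rewrite ltrDl.
  rewrite (cnt_arrived T _ xt) (cnt_arrived T' _ xt) -eqT.
  apply: eq_in_count => u /causal[_ [->//|[tf tf']]].
  by rewrite !(le_lt_trans xt).
by congr (_ * _ + _ * _); apply: eq_ind => //; left.
Qed.

Section Valid.
Variable T : TAP.
Hypothesis T_valid : valid_TAP p T.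

Local Notation h := (tswitch T).
Local Notation f := (tfin T).

Lemma bddm_talloc tau : bddm (talloc T tau : RR -> RR).
Proof.
by apply: bddmD;
  [exact: bddmM (bddm_ind _ _) (bddm_cnt _ _ _) |
   exact: bddmM (bddm_ind _ _) (bddm_cnt _ _ _)].
Qed.

Lemma talloc_ge0 tau t : 0 <= talloc T tau t.
Proof.
apply: addr_ge0; apply: mulr_ge0; rewrite ?ind_ge0 ?prate_ge0 ?srate_ge0 //.
Qed.

Lemma integ_talloc_par tau x : x <= h tau ->
  integ (talloc T tau) (arr tau) x = (pclock T f (arr tau) x)%:E.
Proof.
move=> xh; rewrite /integ integral_lint; last exact: bddm_talloc.
congr (lint _)%:E; apply/funext => t; rewrite /talloc /ind.
have [/andP[at_ tx]|_] := boolP (_ && _); last by rewrite !mul0r.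
have th := lt_le_trans tx xh.
by rewrite at_ th (leNgt (h tau)) th /= !mul1r mul0r addr0.
Qed.

Lemma integ_talloc_ser tau x : x <= f tau ->
  integ (talloc T tau) (h tau) x = (sclock T f (h tau) x)%:E.
Proof.
move=> xf; rewrite /integ integral_lint; last exact: bddm_talloc.
congr (lint _)%:E; apply/funext => t; rewrite /talloc /ind.
have [/andP[ht tx]|_] := boolP (_ && _); last by rewrite !mul0r.
by rewrite ht (ltNge t) ht andbF (lt_le_trans tx xf) /= !mul1r mul0r add0r.
Qed.

Lemma valid_tsched tau : tau \in T -> valid_task_sched p tau (tsched T tau).
Proof.
move=> Tt; have [/andP[ah hf] cp cs hf1 hf2] := the_trajP T_valid Tt.
(* Strict growth of the clock makes the completion time the first instant at which the work is
   done. *)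
have clock_lt phi a b x : is_rate phi -> arr tau <= a -> a <= x -> x < b ->
    b <= f tau -> clock phi T f a x < clock phi T f a b.
  move=> rphi ta ax xb bf; rewrite [ltRHS](clockD _ _ _ ax (ltW xb)) ltrDl.
  exact: (clock_gt0 rphi Tt (le_trans ta ax)).
rewrite /valid_task_sched /tsched /=.
have mt : rmeasurable (talloc T tau) by case: (bddm_talloc tau).
have supp x : x < arr tau \/ f tau <= x -> talloc T tau x = 0.
  move=> out; rewrite /talloc /ind.
  suff [-> ->] : (arr tau <= x) && (x < h tau) = false /\
                 (h tau <= x) && (x < f tau) = false by rewrite !mul0r addr0.
  case: out => [xa|fx].
    by rewrite !leNgt xa (lt_le_trans xa ah).
  by rewrite !ltNge fx (le_trans hf fx) !andbF.
have [hf'|fh] := ltP (h tau) (f tau).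
  have [ltp eqs sw_eq] := hf2 hf'.
  split; rewrite /bounds /=.
  - by rewrite ah hf.
  - by split=> // x; exact: talloc_ge0.
  - move=> [|[|j]] // x _ _; rewrite /run_start /run_end /= => /andP[hx xf].
    rewrite /talloc /ind hx xf (ltNge x) hx andbF mul0r add0r mul1r.
    exact: srate_le1.
  - move=> [|j] // _; rewrite /run_start /run_end /run_work /=.
    by rewrite integ_talloc_par // lte_fin.
  - rewrite /run_start /run_work /= integ_talloc_ser // sw_eq.
    split=> // x /andP[hx xf].
    rewrite integ_talloc_ser ?(ltW xf) // lte_fin -sw_eq.
    by apply: clock_lt => //; exact: is_rate_srate.
have eqhf : h tau = f tau by apply/le_anti; rewrite hf fh.
split; rewrite /bounds /=.
- by rewrite -eqhf ah.
- by split=> // x; exact: talloc_ge0.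
- by move=> [|j].
- by [].
- rewrite /run_start /run_work /= -eqhf integ_talloc_par // hf1 //.
  split=> // x /andP[ax xh].
  rewrite integ_talloc_par ?(ltW xh) // lte_fin -hf1 //.
  by apply: clock_lt => //; exact: is_rate_prate.
Qed.

Lemma sum_nth (F : task -> RR) :
  \sum_(i < size T) F (nth dtask T i) = \sum_(tau <- T) F tau.
Proof. by rewrite (big_nth dtask) big_mkord. Qed.

Lemma sum_ind_cnt b (t : RR) :
  \sum_(tau <- T) ind (arr tau) (b tau) t = (cnt T b t)%:R.
Proof.
rewrite /cnt -sum1_count natr_sum [RHS]big_mkcond.
by apply: eq_bigr => i _; rewrite /ind; case: (_ && _).
Qed.

Lemma talloc_le tau t : tau \in T -> 
  talloc T tau t <= ind (arr tau) (f tau) t * prate p (cnt T f t).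
Proof.
move=> Tt; have [/andP[ah hf] _ _ _ _] := the_trajP T_valid Tt.
rewrite (indD t ah hf) mulrDl lerD2l ler_wpM2l ?ind_ge0 //.
exact: srate_le_prate.
Qed.

Lemma valid_equi : valid_schedule p T (equi T).
Proof.
split=> [i iT|t]; first by apply: valid_tsched; exact: mem_nth.
rewrite (sum_nth (fun tau => talloc T tau t)).
apply: (@le_trans _ _
    (\sum_(tau <- T) ind (arr tau) (f tau) t * prate p (cnt T f t))).
  by rewrite big_seq [leRHS]big_seq; apply: ler_sum => tau; exact: talloc_le.
rewrite -mulr_suml sum_ind_cnt /prate.
have [->|n0] := eqVneq (cnt T f t) 0%N; first by rewrite mul0r ler0n.
by rewrite mulrC divfK // pnatr_eq0.
Qed.

End Valid.
End Schedule.

(** * The competitor's schedule and the final constants *)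

Section Competitor.
Variables (p : nat) (K c : RR) (T : TAP).
Hypotheses (p_gt0 : (0 < p)%N) (K_ge0 : 0 <= K).
Hypothesis T_valid : valid_TAP p T.
Variable S : schedule.
Hypothesis S_valid : valid_noncancel_schedule p (scale_TAP c T) S.

Local Notation task_of i := (nth dtask T i).

Lemma nth_scale i : (i < size T)%N -> nth dtask (scale_TAP c T) i
  = Task (c * sw (task_of i)) (c * pw (task_of i)) (arr (task_of i)).
Proof. by move=> iT; rewrite (nth_map dtask). Qed.

(** Validity caps only the total; this individual bound is what makes each allocation [nice]. *)
Lemma competitor_le_p i t : (i < size T)%N -> alloc (S i) t <= p%:R.
Proof.
move=> iT; have [[task_ok cap] _] := S_valid.
apply: le_trans (cap t); rewrite size_map (bigD1 (Ordinal iT)) //= lerDl.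
apply: sumr_ge0 => j _.
have jT : (j < size (scale_TAP c T))%N by rewrite size_map.
by have [_ [ge0 _] _ _ _] := task_ok j jT.
Qed.

Lemma competitor_task i : (i < size T)%N ->
  [/\ arr (task_of i) <= fin (S i), nice (alloc (S i)),
      forall t, 0 <= alloc (S i) t,
      forall t, alloc (S i) t
        = ind (arr (task_of i)) (fin (S i)) t * alloc (S i) t &
      lint (alloc (S i))
        = c * (if impl0 (S i) then pw (task_of i) else sw (task_of i)) /\
      (impl0 (S i) = false ->
         c * sw (task_of i) <= fin (S i) - arr (task_of i))].
Proof.
move=> iT; have [[task_ok _] no_cancel] := S_valid.
have iT' : (i < size (scale_TAP c T))%N by rewrite size_map.
have le_p t := competitor_le_p t iT.
have := task_ok i iT'; rewrite /valid_task_sched nth_scale //.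
rewrite /bounds /run_start /run_end /run_work /run_impl /bounds no_cancel //=.
move=> [[/andP[ag _] mS] [S0 out] ser _ [work _]].
have bS : bddm (alloc (S i)).
  by split=> //; exists p%:R => t; rewrite ger0_norm.
have supp t : alloc (S i) t = ind (arr (task_of i)) (fin (S i)) t * alloc (S i) t.
  rewrite /ind; have [_|] := boolP (_ && _); first by rewrite mul1r.
  rewrite negb_and -ltNge -leNgt mul0r => /orP outt.
  exact: out.
have nS : nice (alloc (S i)).
  rewrite (_ : alloc (S i) =
    fun t => ind (arr (task_of i)) (fin (S i)) t * alloc (S i) t).
    exact: niceMr (nice_ind _ _) bS.
  by apply/funext.
move: work; rewrite /integ integral_lint // => -[].
rewrite (_ : (fun t => _) = alloc (S i)); last first.
  by apply/funext => t; rewrite -supp.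
rewrite addbF => work; split=> //; split; first by rewrite work; case: (impl0 _).
move=> serial; rewrite serial in work; rewrite -work -(lint_ind ag).
apply: le_lint => //; first exact: nice_ind.
move=> t; rewrite supp /ind; have [/andP[at_ tf]|_] := boolP (_ && _).
  by rewrite mul1r; apply: (ser 0%N) => //; rewrite ?addbF // at_ tf.
by rewrite mul0r.
Qed.

End Competitor.

(** If n < p the rate is 1 and the last term alone suffices, since r / n <= 1; otherwise the rate is
    p / n and the first term equals r / n. *)
Lemma srate_dom (p n : nat) (r : RR) : (0 < p)%N -> (0 < n)%N ->
  0 <= r -> r <= n%:R -> r / n%:R <= r / p%:R * srate p n + srate p n.
Proof.
move=> p0 n0 r0 rn; have n0' : 0 < n%:R :> RR by rewrite ltr0n.
have p0' : 0 < p%:R :> RR by rewrite ltr0n.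
rewrite /srate minElt; case: ifP => _.
  apply: (@le_trans _ _ 1); first by rewrite ler_pdivrMr ?mul1r.
  by rewrite mulr1 lerDr divr_ge0 // ltW.
by rewrite mulrA divfK ?gt_eqF // lerDl prate_ge0.
Qed.

(** The serial clock of a task totals at most 8 + 1 = 9 times [sw], and 72 = 8 * 9 makes this 1/8 of
    the competitor's serial work. With all three parameters 1/8, [competitive] reads TRT <= 9/4 OPT
    + 1/2 TRT, whence 9/2. *)
Lemma equi_competitive (p : nat) (T : TAP) (S : schedule) :
  (0 < p)%N -> valid_TAP p T ->
  valid_noncancel_schedule p (scale_TAP 72 T) S ->
  TRT T (equi p 8 T) <= 9 / 2 * TRT (scale_TAP 72 T) S.
Proof.
move=> p0 vT vS.
have K0 : 0 <= 8 :> RR by [].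
pose tk (i : 'I_(size T)) := nth dtask T i.
pose h := tswitch p 8 T; pose f := tfin p 8 T.
have Tt i : tk i \in T by exact: mem_nth.
have tr i : task_traj p 8 T h f (tk i) := the_trajP p0 K0 vT (Tt i).
have comp i := competitor_task vS (ltn_ord i).
(* The choice follows the competitor's job. Against a parallel job, [q] is the full allocation and
   [w] its serial phase; against a serial job the allocation may far exceed [sw], so both are the
   serial clock over the whole life of the task. *)
pose w (i : 'I_(size T)) (t : RR) :=
  ind (if impl0 (S i) then h (tk i) else arr (tk i)) (f (tk i)) t * srate p (cnt T f t).
pose q (i : 'I_(size T)) (t : RR) :=
  if impl0 (S i) then talloc p 8 T (tk i) t else w i t.
have aliveE (t : RR) :
    alive (fun i => arr (tk i)) (fun i => f (tk i)) t = (cnt T f t)%:R.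
  rewrite /alive -sum_ind_cnt.
  exact: (sum_nth T (fun tau => ind (arr tau) (f tau) t)).
have p0' : 0 < p%:R :> RR by rewrite ltr0n.
have := @competitive RR (size T) (fun i => arr (tk i)) (fun i => f (tk i))
  (fun i => fin (S i)) (fun i => alloc (S i)) q w p%:R (1/8) (1/8) (1/8) p0'.
have sw0 i : 0 < sw (tk i) by case: (valid_mem vT (Tt i)).
have swpw i : sw (tk i) <= pw (tk i) by case: (valid_mem vT (Tt i)) => _ [].
have ah i : arr (tk i) <= h (tk i) by case: (tr i) => /andP[].
have hf i : h (tk i) <= f (tk i) by case: (tr i) => /andP[].
have af i : arr (tk i) <= f (tk i) := le_trans (ah i) (hf i).
have nalloc i : nice (talloc p 8 T (tk i)).
  apply: niceD; exact: nice_clock.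
have nw i : nice (w i) by exact: nice_clock.
have w_ge0 i t : 0 <= w i t by rewrite mulr_ge0 ?ind_ge0 ?srate_ge0.
have nq i : nice (q i) by rewrite /q; case: (impl0 _).
have q_ge0 i t : 0 <= q i t.
  by rewrite /q; case: (impl0 _); rewrite ?talloc_ge0.
(* The serial clock runs at rate at most 1, so a task cancelled at clock [8 * sw] has been alive at
   least that long. *)
have sserial i : clock (srate p) T f (h (tk i)) (f (tk i)) <= sw (tk i) /\
    8 * clock (srate p) T f (h (tk i)) (f (tk i)) <= f (tk i) - arr (tk i).
  have [_ _ _ _ ser] := tr i; have := hf i.
  rewrite le_eqVlt => /predU1P[->|hf'].
    by rewrite clock_xx mulr0 subr_ge0 af ltW.
  have [_ s8 ->] := ser hf'; rewrite lexx -s8; split=> //.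
  apply: (@le_trans _ _ (1 * (h (tk i) - arr (tk i)))).
    by apply: clock_le => // t _ _; exact: srate_le1.
  by rewrite mul1r lerD2r.
have lint_w i : lint (w i) = clock (srate p) T f
    (if impl0 (S i) then h (tk i) else arr (tk i)) (f (tk i)) by [].
have sall i : clock (srate p) T f (arr (tk i)) (f (tk i)) <= 9 * sw (tk i).
  rewrite (clockD _ _ _ (ah i) (hf i)); have [s1 _] := sserial i.
  by have [_ _ s8 _ _] := tr i; lra.
have lint_alloc i : lint (talloc p 8 T (tk i)) <= 2 * pw (tk i).
  rewrite lintD; [|exact: nice_clock..].
  have [_ cp _ _ _] := tr i; have [s1 _] := sserial i.
  by have := swpw i; rewrite /clock in cp s1; lra.
have sumE : \sum_i (f (tk i) - arr (tk i)) = TRT T (equi p 8 T) by [].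
have sumE' : \sum_(i < size T) (fin (S i) - arr (tk i)) = TRT (scale_TAP 72 T) S.
  pose F (j : nat) := fin (S j) - arr (nth dtask (scale_TAP 72 T) j).
  rewrite /TRT -(big_mkord xpredT F) size_map big_mkord.
  by apply: eq_bigr => i _; rewrite /F nth_scale.
rewrite sumE sumE'; move=> comp_le.
suff : TRT T (equi p 8 T) <= 2 * (1 + 1 / 8) * TRT (scale_TAP 72 T) S
    + 2 * (1 / 8 + 1 / 8) * TRT T (equi p 8 T) by lra.
apply: comp_le => //.
- lra.
- by move=> i; case: (comp i).
- by move=> i; case: (comp i).
- by move=> i; case: (comp i).
- by move=> i; case: (comp i).
- move=> t; have [[_ cap] _] := vS.
  have := cap t; rewrite -(big_mkord xpredT (fun j : nat => alloc (S j) t)).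
  by rewrite size_map big_mkord.
- move=> i t r at_ tf r0; rewrite aliveE => rn.
  have n0 : (0 < cnt T f t)%N := cnt_gt0 (Tt i) at_ tf.
  have dom := srate_dom p0 n0 r0 rn.
  rewrite /q /w; case: (impl0 _); last by rewrite /ind at_ tf mul1r.
  rewrite /talloc -/h -/f /ind at_ tf; have [th|ht] := ltP t (h (tk i)).
    rewrite !mul0r mul1r !addr0 /prate mulrA divfK ?gt_eqF //.
  by rewrite !mul1r mul0r add0r.
- move=> i; have [_ _ _ _ [-> _]] := comp i.
  have s0 := sw0 i; have sp := swpw i.
  rewrite /q -/(tk i); case: ifP => [_|imp].
    by apply: (le_trans (lint_alloc i)); lra.
  have -> : lint (fun t => w i t) = lint (w i) by [].
  by rewrite lint_w imp; have := sall i; lra.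
(* Against a parallel job the serial phase is paid by the scheduler's own response time; against a
   serial job the competitor's response time is at least [72 * sw], which pays for [9 * sw]. *)
- move=> i; have [ag _ _ _ [_]] := comp i; rewrite -/(tk i) in ag *.
  rewrite lint_w; case: ifP => [_ _|_ /(_ erefl) serl].
    by have [_ s8] := sserial i; lra.
  by have := sall i; have := af i; lra.
Qed.

(* TRT_ALG(T) <= C * TRT_OPT(c.T), where TRT_OPT(c.T) is the infimum of TRT
   over all offline non-cancelling schedules of c.T; since C > 0 this is
   equivalent to the bound against every such schedule. *)
Theorem theorem6p3 :
  exists (c C : RR), 1 <= c /\ 1 <= C /\
  exists p0 : nat, forall p : nat, (p0 <= p)%N ->
    exists A : scheduler, online_cancelling_scheduler p A /\
      forall T : TAP, valid_TAP p T ->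
        forall S : schedule, valid_noncancel_schedule p (scale_TAP c T) S ->
          TRT T (A T) <= C * TRT (scale_TAP c T) S.
Proof.
exists 72, (9 / 2); split; first lra; split; first lra.
exists 1%N => p p0; exists (equi p 8); split.
  by split=> [|T vT]; [exact: equi_online | exact: valid_equi].
by move=> T vT S; exact: equi_competitive.
Qed.
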